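(* Let $q$ be a power of a prime $p\ge5$. Let $u\in\mathbb F_q$ be such that $1-u+u^2$ is a nonsquare in $\mathbb F_q$, and let $t=-u^3$, $s=3(-u+u^2)$. Then $f_{s,t}$ is in Class III-d, $G_{s,t}=(X-u)^2(X^2+2(u-1)X-u)$ with $X^2+2(u-1)X-u$ irreducible over $\mathbb F_q$, and the ramification type of $f_{s,t}$ is $(2/2,\,2/2,\,3/1)$. If $q\equiv1\pmod 6$, then $f_{-3,1}$ also belongs to Class III-d; in this case $G_{-3,1}=(1-X+X^2)^2=\bigl((X+\epsilon)(X+\epsilon^2)\bigr)^2$, where $\epsilon\in\mathbb F_q$ has multiplicative order $3$, and the ramification type of $f_{-3,1}$ is $(3/1,\,3/1)$.
   Context: $\mathbb F_q$ is the field with $q$ elements and $\overline{\mathbb F}_q$ an algebraic closure. For $s,t\in\mathbb F_q$ with $t(1+s+t)\neq0$, $f_{s,t}=\frac{X^3+sX+t}{X(X-1)}$ and $G_{s,t}(X)=X^4-2X^3-sX^2-2tX+t$. $f_{s,t}$ is in Class III-d if $G_{s,t}$ has at least one root in $\mathbb F_q$ and every root $x\in\mathbb F_q$ of $G_{s,t}$ satisfies $x^3=-t$. For $f\in\mathbb F_q(X)$ and $a\in\mathbb P^1(\overline{\mathbb F}_q)$, the ramification index $e_f(a)$ is $\nu_{X-a}(f(X)-f(a))$ if $a,f(a)\neq\infty$; $\nu_{X-a}(1/f)$ if $a\neq\infty=f(a)$; $\nu_X(f(1/X)-f(\infty))$ if $a=\infty\neq f(\infty)$; $\nu_X(1/f(1/X))$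 if $a=\infty=f(\infty)$ ($\nu_{X-a}$ = order of vanishing at $X=a$). A ramification point is an $a$ with $e_f(a)>1$; its degree is $[\mathbb F_q(a):\mathbb F_q]$ (degree $1$ for $a=\infty$), and it is said to be of type $e/d$ if its index is $e$ and its degree is $d$. The ramification type of $f$ is the unordered list of the types $e/d$ of all ramification points of $f$ in $\mathbb P^1(\overline{\mathbb F}_q)$. *)

(* Defs.v *)
From HB Require Import structures.
From mathcomp Require Import all_boot all_order all_algebra all_field.

Set Implicit Arguments.
Unset Strict Implicit.
Unset Printing Implicit Defensive.

Import GRing.Theory Num.Theory.
Local Open Scope ring_scope.

(* The field of rational functions in one variable over K. *)
Notation "{ 'ratfrac' K }" := {fraction {poly K}} (format "{ 'ratfrac'  K }").

(* The polynomial p seen as a rational function. *)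
Notation toratfrac := (@FracField.tofrac (GRing.IntegralDomain.clone _ {poly _})).

(* A reduced expression of f: ratfrac_num f and ratfrac_den f are coprime, and
   f is their quotient.  It is unique only up to a nonzero scalar; the
   definitions below do not depend on this scalar. *)
Definition ratfrac_num (K : fieldType) (f : {ratfrac K}) : {poly K} :=
  \n_(repr f) %/ gcdp \n_(repr f) \d_(repr f).

Definition ratfrac_den (K : fieldType) (f : {ratfrac K}) : {poly K} :=
  \d_(repr f) %/ gcdp \n_(repr f) \d_(repr f).

Definition ratfrac_map (F K : fieldType) (iota : {rmorphism F -> K})
    (f : {ratfrac F}) : {ratfrac K} :=
  toratfrac (map_poly iota (ratfrac_num f)) /
  toratfrac (map_poly iota (ratfrac_den f)).

(* The rational function f(1/X). *)
Definition ratfrac_invX (K : fieldType) (f : {ratfrac K}) : {ratfrac K} :=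
  (map_poly (fun c : K => toratfrac c%:P) (ratfrac_num f)).[(toratfrac 'X)^-1] /
  (map_poly (fun c : K => toratfrac c%:P) (ratfrac_den f)).[(toratfrac 'X)^-1].

(* The order of vanishing nu_{X-a} (negative at a pole); the value at f = 0 is
   meaningless. *)
Definition ratfrac_ord (K : fieldType) (a : K) (f : {ratfrac K}) : int :=
  (mup a (ratfrac_num f))%:Z - (mup a (ratfrac_den f))%:Z.

(* The projective line P^1(K) is represented by option K, None being the point
   at infinity. *)
Definition ratfrac_eval_fin (K : fieldType) (f : {ratfrac K}) (a : K) :
    option K :=
  if (ratfrac_den f).[a] == 0 then None
  else Some ((ratfrac_num f).[a] / (ratfrac_den f).[a]).

Definition ratfrac_eval (K : fieldType) (f : {ratfrac K}) (a : option K) :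
    option K :=
  match a with
  | Some a => ratfrac_eval_fin f a
  | None => ratfrac_eval_fin (ratfrac_invX f) 0
  end.

(* Intended for nonconstant f. *)
Definition ram_index (K : fieldType) (f : {ratfrac K}) (a : option K) : int :=
  match a, ratfrac_eval f a with
  | Some a, Some b => ratfrac_ord a (f - toratfrac b%:P)
  | Some a, None => ratfrac_ord a f^-1
  | None, Some b => ratfrac_ord 0 (ratfrac_invX f - toratfrac b%:P)
  | None, None => ratfrac_ord 0 (ratfrac_invX f)^-1
  end.

(* d = [F(a) : F].  Since K need not be finite-dimensional over F, while
   subfields and their dimensions are only available inside a finite extension,
   the degree is computed in some finite extension L of F, embedded in K over F,
   that contains a. *)
Definition point_degree (F K : fieldType) (iota : {rmorphism F -> K})
    (a : option K) (d : nat) : Prop :=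
  match a with
  | Some a =>
      exists (L : fieldExtType F) (j : {rmorphism L -> K}) (z : L),
        [/\ forall c : F, j c%:A = iota c, j z = a & \dim <<1; z>>%VS = d]
  | None => d = 1%N
  end.

(* T lists, in any order and with multiplicities, the pairs (e, d) such that
   the ramification points of f in P^1(K) are of type e/d. *)
Definition has_ramification_type (F K : fieldType) (iota : {rmorphism F -> K})
    (f : {ratfrac F}) (T : seq (int * nat)) : Prop :=
  let e := ram_index (ratfrac_map iota f) in
  exists (pts : seq (option K)) (deg : option K -> nat),
    [/\ uniq pts,
        forall a, (a \in pts) = (1 < e a),
        forall a, a \in pts -> point_degree iota a (deg a)
      & perm_eq T [seq (e a, deg a) | a <- pts]].

Definition f_ (F : fieldType) (s t : F) : {ratfrac F} :=
  toratfrac ('X^3 + s *: 'X + t%:P) / toratfrac ('X * ('X - 1)).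

Definition G_ (F : fieldType) (s t : F) : {poly F} :=
  'X^4 - 2 *: 'X^3 - s *: 'X^2 - (2 * t) *: 'X + t%:P.

(* The condition t (1 + s + t) != 0 is the one under which f_ s t is
   considered: it says that its numerator and denominator are coprime. *)
Definition class_IIId (F : fieldType) (s t : F) : Prop :=
  [/\ t * (1 + s + t) != 0,
      exists x : F, root (G_ s t) x
    & forall x : F, root (G_ s t) x -> x ^+ 3 = - t].

(* Main.v *)
(* The derivative of f = N/D is G/D^2, so apart from the simple poles 0, 1 and
   infinity, which are unramified, the ramification points of f_{s,t} are the
   roots of G_{s,t}; at a root a the index is the multiplicity of a in
   N - f(a) D, and it is 2 when a is a simple root of G.  If t = -u^3 and
   s = 3(u^2 - u), then N - 3u D = (X - u)^3, so the index at u is 3.  The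
   quadratic cofactor of (X - u)^2 in G has discriminant 4(1 - u + u^2), hence
   it is irreducible and contributes two conjugate points of index 2.  For
   (s, t) = (-3, 1) both double roots of G play the role of u. *)
Require Import Defs.
From HB Require Import structures.
From mathcomp Require Import all_boot all_order all_algebra all_field.
From mathcomp Require Import all_fingroup all_solvable.
From mathcomp Require Import generic_quotient ring.

Set Implicit Arguments.
Unset Strict Implicit.
Unset Printing Implicit Defensive.

Import GRing.Theory Num.Theory.
Local Open Scope ring_scope.

(** * Reduced fractions: computing with any coprime numerator and denominator *)

Section RationalFunctions.

Variable K : fieldType.
Implicit Types (N D : {poly K}) (f : {ratfrac K}).

(** Links the quotient construction, through which [ratfrac_num] and [ratfrac_den] are defined, to
    division in the fraction field; it comes down to cross-multiplication of representatives. *)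
Lemma tofrac_repr f :
  f = toratfrac \n_(repr f) / toratfrac \d_(repr f).
Proof.
have d0 : toratfrac \d_(repr f) != 0 by rewrite tofrac_eq0 denom_ratioP.
apply: (canRL (mulfK d0)); rewrite -[f in LHS]reprK.
rewrite /FracField.tofrac; unlock.
rewrite -[LHS]FracField.pi_mul; apply/eqmodP => /=.
rewrite FracField.equivfE /FracField.mulf !numden_Ratio ?oner_eq0 ?mulr1 //.
  by rewrite reprK mulrC.
all: by rewrite denom_ratioP.
Qed.

Lemma tofrac_div_eq N D N' D' : D != 0 -> D' != 0 ->
  toratfrac N / toratfrac D = toratfrac N' / toratfrac D' -> N * D' = N' * D.
Proof.
move=> D0 D'0 /eqP; rewrite eqr_div ?tofrac_eq0 // -!tofracM tofrac_eq.
by move/eqP.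
Qed.

(** Cross-multiplying two coprime expressions of f, Gauss's lemma makes each denominator divide the
    other, so they differ by a unit, and then so do the numerators. Every notion built on the chosen
    reduced form can thus be evaluated on any coprime pair. *)
Lemma ratfrac_num_den_coprime N D :
  D != 0 -> coprimep N D ->
  exists2 c : K, c != 0 &
    let f := toratfrac N / toratfrac D in
    ratfrac_num f = c *: N /\ ratfrac_den f = c *: D.
Proof.
move=> D0 cND; set f := _ / _; rewrite /ratfrac_num /ratfrac_den.
set n := \n_(repr f); set d := \d_(repr f).
have d0 : d != 0 by rewrite denom_ratioP.
have g0 : gcdp n d != 0 by rewrite gcdp_eq0 negb_and d0 orbT.
have e : n * D = N * d.
  by apply: tofrac_div_eq; rewrite // -tofrac_repr.
set n' := n %/ _; set d' := d %/ _.
have nE : n = n' * gcdp n d by rewrite divpK ?dvdp_gcdl.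
have dE : d = d' * gcdp n d by rewrite divpK ?dvdp_gcdr.
have c' : coprimep n' d' by rewrite coprimep_div_gcd // d0 orbT.
have e' : n' * D = N * d'.
  by apply: (mulIf g0); rewrite -mulrA [D * _]mulrC mulrA -nE e {1}dE mulrA.
have : d' %= D.
  apply/andP; split.
    by rewrite -(@Gauss_dvdpr _ _ n' d') ?e' ?dvdp_mull // coprimep_sym.
  by rewrite -(@Gauss_dvdpr _ _ N D) -?e' ?dvdp_mull // coprimep_sym.
move=> h; have /eqpP[[c1 c2] /= /andP[c10 c20] ec] := h.
have d'E : d' = (c2 / c1) *: D.
  by rewrite mulrC -scalerA -ec scalerA mulVf ?scale1r.
exists (c2 / c1); first by rewrite mulf_neq0 ?invr_eq0.
split=> //; apply: (mulIf D0); rewrite e' d'E.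
by rewrite -scalerAl -scalerAr.
Qed.

Lemma ratfrac_ord_coprime a N D : D != 0 -> coprimep N D ->
  ratfrac_ord a (toratfrac N / toratfrac D) = (mup a N)%:Z - (mup a D)%:Z.
Proof.
move=> D0 cND; have [c c0 [e1 e2]] := ratfrac_num_den_coprime D0 cND.
by rewrite /ratfrac_ord e1 e2 -!mul_polyC !mupMr ?rootC ?(negPf c0).
Qed.

Lemma ratfrac_eval_fin_coprime a N D : D != 0 -> coprimep N D ->
  ratfrac_eval_fin (toratfrac N / toratfrac D) a =
    if D.[a] == 0 then None else Some (N.[a] / D.[a]).
Proof.
move=> D0 cND; have [c c0 [e1 e2]] := ratfrac_num_den_coprime D0 cND.
by rewrite /ratfrac_eval_fin e1 e2 !hornerZ mulf_eq0 (negPf c0) -mulf_div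
  divff ?mul1r.
Qed.

Lemma tofrac_div_subC N D b : D != 0 ->
  toratfrac N / toratfrac D - toratfrac b%:P
    = toratfrac (N - b *: D) / toratfrac D.
Proof.
by move=> D0; rewrite tofracB mulrBl -mul_polyC tofracM mulfK ?tofrac_eq0.
Qed.

End RationalFunctions.

Lemma ratfrac_map_coprime (F K : fieldType) (iota : {rmorphism F -> K}) N D :
  D != 0 -> coprimep N D ->
  ratfrac_map iota (toratfrac N / toratfrac D) =
    toratfrac (map_poly iota N) / toratfrac (map_poly iota D).
Proof.
move=> D0 cND; have [c c0 [e1 e2]] := ratfrac_num_den_coprime D0 cND.
rewrite /ratfrac_map e1 e2 !map_polyZ -!mul_polyC !tofracM -mulf_div
  divff ?mul1r //.
by rewrite tofrac_eq0 polyC_eq0 fmorph_eq0.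
Qed.

Lemma ratfrac_invX_coprime (K : fieldType) (N D : {poly K}) :
  D != 0 -> coprimep N D ->
  let sub P := (map_poly (fun c : K => toratfrac c%:P) P).[(toratfrac 'X)^-1] in
  ratfrac_invX (toratfrac N / toratfrac D) = sub N / sub D.
Proof.
move=> D0 cND; have [c c0 [e1 e2]] := ratfrac_num_den_coprime D0 cND.
rewrite /= /ratfrac_invX e1 e2.
pose j : {rmorphism K -> {ratfrac K}} := toratfrac \o polyC.
rewrite -[fun c : K => _]/(j : _ -> _) !map_polyZ !hornerZ -mulf_div
  divff ?mul1r //.
by rewrite fmorph_eq0.
Qed.

(** * Degrees of points over the base field *)

Lemma point_degree_root (F K : fieldType) (iota : {rmorphism F -> K})
    (p : {poly F}) (z : K) :
  irreducible_poly p -> root (map_poly iota p) z ->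
  point_degree iota (Some z) (size p).-1.
Proof.
move=> irr_p pz; have p0 := irredp_neq0 irr_p.
(* The finite extension is F[X]/(p), embedded in K by sending the class of X to z. That class
   generates it, so the degree is that of p. *)
pose L := SubFieldExtType pz irr_p.
exists L, (subfx_inj : {rmorphism L -> K}), (subfx_root iota z p : L).
split; [by move=> c; apply: subfx_inj_base | exact: subfx_inj_root |].
suff -> : <<1; (subfx_root iota z p : L)>>%VS = fullv by rewrite dimvf.
apply/vspaceP => x; rewrite memvf; apply/Fadjoin_polyP.
have [q ->] := subfxEroot pz p0 x.
by exists (map_poly (in_alg L) q) => //; apply/polyOverP => i;
  rewrite coef_map memvZ ?mem1v.
Qed.

(** * Indices of f at finite points, at its finite poles and at infinity *)

Definition f_num (F : fieldType) (s t : F) : {poly F} := 'X^3 + s *: 'X + t%:P.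

Definition f_den (F : fieldType) : {poly F} := 'X * ('X - 1).

(** The substitution X -> 1/X in f, isolated over an abstract field so that [field] does not meet
    the fraction field itself. *)
Lemma cubic_ratio_invX (L : fieldType) (a b x : L) : x != 0 -> 1 - x != 0 ->
  (x^-1 ^+ 3 + a * x^-1 + b) / (x^-1 * (x^-1 - 1))
    = (1 + a * x ^+ 2 + b * x ^+ 3) / (x * (1 - x)).
Proof. by move=> x0 x1; field; rewrite x0 x1. Qed.

Section Ramification.

Variables (K : fieldType) (s t : K).
Hypothesis st_neq0 : t * (1 + s + t) != 0.

Let N := f_num s t.
Let D := f_den K.

Lemma f_denE : D = ('X - 0%:P) * ('X - 1%:P).
Proof. by rewrite /D /f_den subr0. Qed.

Lemma f_den_neq0 : D != 0.
Proof. by rewrite f_denE mulf_neq0 ?polyXsubC_eq0. Qed.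

Lemma f_den_root a : root D a = (a == 0) || (a == 1).
Proof. by rewrite f_denE rootM !root_XsubC. Qed.

Lemma f_num0 : N.[0] = t.
Proof. by rewrite /N /f_num !hornerE; ring. Qed.

Lemma f_num1 : N.[1] = 1 + s + t.
Proof. by rewrite /N /f_num !hornerE; ring. Qed.

Lemma f_coprime : coprimep N D.
Proof.
have /norP[t0 st0] : ~~ ((t == 0) || (1 + s + t == 0)) by rewrite -mulf_eq0.
by rewrite f_denE coprimepMr !coprimep_XsubC !rootE f_num0 f_num1 t0 st0.
Qed.

Lemma f_den_mup a : root D a -> mup a D = 1%N.
Proof.
rewrite f_den_root f_denE mupM ?polyXsubC_eq0 // -['X - 0%:P]expr1.
rewrite -['X - 1%:P]expr1 !mup_XsubCX => /orP[]/eqP->.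
  by rewrite eqxx oner_eq0.
by rewrite eqxx eq_sym oner_eq0.
Qed.

(** Subtracting a multiple of D from N keeps it coprime to D, so f - f(a) is already reduced, and
    its denominator does not vanish at a. *)
Lemma ram_index_finite a : ~~ root D a ->
  ram_index (f_ s t) (Some a) = (mup a (N - (N.[a] / D.[a]) *: D))%:Z.
Proof.
move=> Da; have D0 := f_den_neq0; have cND := f_coprime.
rewrite /ram_index /= /f_ -/(f_num s t) -/(f_den K) -/N -/D.
rewrite ratfrac_eval_fin_coprime // -rootE (negPf Da) /=.
rewrite tofrac_div_subC //.
rewrite ratfrac_ord_coprime // ?(mupNroot Da) ?subr0 //.
rewrite coprimep_sym in cND; rewrite coprimep_sym -mul_polyC.
by rewrite -mulNr addrC coprimep_addl_mul.
Qed.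

Lemma ram_index_pole a : root D a -> ram_index (f_ s t) (Some a) = 1.
Proof.
move=> Da; have D0 := f_den_neq0; have cND := f_coprime.
rewrite /ram_index /= /f_ -/(f_num s t) -/(f_den K) -/N -/D.
rewrite ratfrac_eval_fin_coprime // -rootE Da invf_div.
have Na : ~~ root N a.
  by apply/negP => /(coprimep_root cND); rewrite -rootE Da.
have N0 : N != 0 by apply: contraNneq Na => ->; rewrite root0.
by rewrite ratfrac_ord_coprime // 1?coprimep_sym // f_den_mup // mupNroot.
Qed.

Lemma ram_index_infty : ram_index (f_ s t) None = 1.
Proof.
(* Numerator and denominator of f(1/X), both multiplied by X^3. The new denominator is -D, so
   infinity is a simple pole. *)
pose N1 : {poly K} := 1 + s *: 'X^2 + t *: 'X^3.
pose D1 : {poly K} := 'X * (1 - 'X).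
have D1E : D1 = (-1) *: D by rewrite /D1 /D /f_den scaleN1r -mulrN opprB.
have D10 : D1 != 0 by rewrite D1E scaler_eq0 oppr_eq0 oner_eq0 f_den_neq0.
have /norP[t0 st0] : ~~ ((t == 0) || (1 + s + t == 0)) by rewrite -mulf_eq0.
have N10 : N1.[0] = 1
  by rewrite /N1 !(hornerD, hornerZ, hornerXn, hornerC) !expr0n !mulr0 !addr0.
have c1 : coprimep N1 D1.
  rewrite D1E coprimepZr ?oppr_eq0 ?oner_eq0 // f_denE coprimepMr.
  rewrite !coprimep_XsubC !rootE N10 oner_eq0 /N1.
  rewrite !(hornerD, hornerZ, hornerXn, hornerC) !expr1n !mulr1.
  by rewrite st0.
have e : ratfrac_invX (f_ s t) = toratfrac N1 / toratfrac D1.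
  rewrite /f_ -/(f_num s t) -/(f_den K) ratfrac_invX_coprime ?f_den_neq0 //;
    last exact: f_coprime.
  pose j : {rmorphism K -> {ratfrac K}} := toratfrac \o polyC.
  rewrite -[fun c : K => _]/(j : _ -> _); set x : {ratfrac K} := toratfrac 'X.
  have x0 : x != 0 by rewrite tofrac_eq0 polyX_eq0.
  have -> : (map_poly j (f_num s t)).[x^-1] = x^-1 ^+ 3 + j s * x^-1 + j t.
    by rewrite /f_num !rmorphD /= map_polyXn map_polyC map_polyZ map_polyX
      !hornerE.
  have -> : (map_poly j (f_den K)).[x^-1] = x^-1 * (x^-1 - 1).
    by rewrite /f_den rmorphM rmorphB /= rmorph1 map_polyX !hornerE.
  have -> : toratfrac N1 = 1 + j s * x ^+ 2 + j t * x ^+ 3.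
    rewrite /N1 -!mul_polyC !tofracD tofrac1 (tofracM s%:P 'X^2).
    by rewrite (tofracM t%:P 'X^3) (tofracXn 2 'X) (tofracXn 3 'X).
  have D1x : toratfrac D1 = x * (1 - x) by rewrite /D1 tofracM tofracB tofrac1.
  have x1 : 1 - x != 0.
    by move: D10; rewrite -tofrac_eq0 D1x mulf_eq0 (negPf x0).
  rewrite D1x; move: (j s) (j t) x0 x1 {D1x}; clearbody x; clear => a b x0 x1.
  by have := cubic_ratio_invX a b x0 x1.
have N0 : N1 != 0.
  by apply: contra_eq_neq N10 => ->; rewrite horner0 eq_sym oner_eq0.
rewrite /ram_index /ratfrac_eval e ratfrac_eval_fin_coprime //.
have -> : D1.[0] = 0.
  apply/rootP; rewrite D1E rootZ ?oppr_eq0 ?oner_eq0 //.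
  by rewrite f_den_root eqxx.
rewrite eqxx invf_div ratfrac_ord_coprime // 1?coprimep_sym //.
rewrite (mupNroot (q := N1)) ?rootE ?N10 ?oner_eq0 // D1E -mul_polyC.
rewrite mupMr ?rootC ?oppr_eq0 ?oner_eq0 // f_den_mup //.
by rewrite f_den_root eqxx.
Qed.

End Ramification.

(** * Multiplicities in the fibres of f, read off from a Wronskian *)

Lemma mup_gt1_wronskian (K : fieldType) (P D : {poly K}) a :
  P != 0 -> root P a -> ~~ root D a ->
  (1 < mup a P)%N = root (P^`() * D - P * D^`()) a.
Proof.
(* With P = R (X - a), the Wronskian takes the value R(a) D(a) at a, so it vanishes exactly when R
   does. *)
move=> P0 Pa Da; rewrite mup_geq //; have /factor_theorem[R PR] := Pa.
rewrite PR exprS expr1 dvdp_mul2r ?polyXsubC_eq0 // dvdp_XsubCl.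
rewrite [RHS]rootE derivM derivXsubC.
rewrite !(hornerD, hornerN, hornerM, hornerX, hornerC) subrr.
by rewrite !mulr0 add0r mulr1 mul0r subr0 mulf_eq0 -!rootE (negPf Da) orbF.
Qed.

Lemma dvdp_wronskian (K : fieldType) (P D : {poly K}) a n :
  ('X - a%:P) ^+ n.+1 %| P -> ('X - a%:P) ^+ n %| P^`() * D - P * D^`().
Proof.
move=> dvdP; rewrite dvdp_sub ?dvdp_mulr //; last first.
  by apply: dvdp_trans dvdP; rewrite exprS dvdp_mulIr.
have /dvdpP[R ->] := dvdP; rewrite derivM deriv_exp derivXsubC mul1r /=.
by rewrite dvdp_add ?exprS ?dvdp_mull // -mulr_natl dvdp_mull.
Qed.

Section Ramification.

Variables (K : fieldType) (s t : K).
Hypothesis st_neq0 : t * (1 + s + t) != 0.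

Let N := f_num s t.
Let D := f_den K.

(** The Wronskian of D with itself is zero, so the value does not depend on b: one polynomial G
    detects the multiple points of all fibres. *)
Lemma G_wronskian b :
  G_ s t = (N - b *: D)^`() * D - (N - b *: D) * D^`().
Proof.
rewrite /G_ /N /f_num /D /f_den !derivE.
rewrite -!mul_polyC !rmorphM /= !rmorph_nat.
ring.
Qed.

(** G(0) = t and G(1) = -(1 + s + t), both nonzero by hypothesis. *)
Lemma f_den_nonroot a : root (G_ s t) a -> ~~ root D a.
Proof.
rewrite f_den_root; apply: contraL => /orP[]/eqP->; apply: contraNN st_neq0.
  rewrite rootE /G_ !(hornerD, hornerN, hornerZ, hornerXn, hornerX, hornerC).
  move/eqP => h; apply/eqP; rewrite (_ : t = 0) ?mul0r // -h; ring.
rewrite rootE /G_ !(hornerD, hornerN, hornerZ, hornerXn, hornerX, hornerC).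
move/eqP => h; apply/eqP; rewrite (_ : 1 + s + t = 0) ?mulr0 //.
by apply/eqP; rewrite -oppr_eq0 -h; apply/eqP; ring.
Qed.

Section FinitePoint.

Variable a : K.
Hypothesis Da : ~~ root D a.

Let P := N - (N.[a] / D.[a]) *: D.

Lemma f_fiber_neq0 : P != 0.
Proof.
(* Otherwise N would be a multiple of D and share its root 0. *)
apply: contraTneq (f_coprime st_neq0) => /eqP.
rewrite subr_eq0 => /eqP; rewrite -/N -/D => ->.
rewrite -mul_polyC; apply/negP => c; have := coprimep_root c (x := 0).
rewrite rootM f_den_root eqxx orbT -rootE f_den_root eqxx.
by move/(_ isT).
Qed.

Lemma f_fiber_root : root P a.
Proof.
by rewrite rootE /P hornerD hornerN hornerZ divfK ?subrr // -rootE.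
Qed.

Lemma mup_f_fiber_gt1 : (1 < mup a P)%N = root (G_ s t) a.
Proof.
by rewrite (mup_gt1_wronskian _ _ Da) ?f_fiber_neq0 ?f_fiber_root //
  -G_wronskian.
Qed.

Lemma mup_f_fiber_gt2 : (2 < mup a P)%N -> ('X - a%:P) ^+ 2 %| G_ s t.
Proof.
rewrite mup_geq ?f_fiber_neq0 // (G_wronskian (N.[a] / D.[a])).
exact: dvdp_wronskian.
Qed.

End FinitePoint.

Lemma ram_index_gt1 a :
  (1 < ram_index (f_ s t) a) = if a is Some x then root (G_ s t) x else false.
Proof.
case: a => [a|]; last by rewrite ram_index_infty.
have [Da|Da] := boolP (root D a).
  by rewrite ram_index_pole //; apply/esym; apply: contraTF Da;
    apply: f_den_nonroot.
by rewrite ram_index_finite // ltz_nat mup_f_fiber_gt1.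
Qed.

(** A root of G has index at least 2, while index 3 or more would make it a multiple root of G. *)
Lemma ram_index_eq2 a : root (G_ s t) a -> ~~ (('X - a%:P) ^+ 2 %| G_ s t) ->
  ram_index (f_ s t) (Some a) = 2%:Z.
Proof.
move=> Ga Ga2; have Da := f_den_nonroot Ga; rewrite ram_index_finite //.
congr Posz; apply/eqP; rewrite eqn_leq mup_f_fiber_gt1 // Ga andbT leqNgt.
by apply: contra Ga2; apply: mup_f_fiber_gt2.
Qed.

Lemma ram_index_eq3 a : t = - a ^+ 3 -> s = 3 * (- a + a ^+ 2) ->
  ram_index (f_ s t) (Some a) = 3%:Z.
Proof.
move=> tE sE.
(* For a = 0 the parameters give t = 0, and for a = 1 they give 1 + s + t = 0. *)
have Da : ~~ root D a.
  rewrite f_den_root; apply: contra st_neq0 => h; apply/eqP.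
  by case/orP: h => /eqP h; rewrite tE sE h; ring.
rewrite ram_index_finite // -/N -/D.
have Da0 : D.[a] != 0 by rewrite -rootE.
have -> : N.[a] / D.[a] = 3 * a.
  apply: (canLR (mulfK Da0)); rewrite /N /D /f_num /f_den tE sE.
  rewrite !(hornerM, hornerD, hornerN, hornerZ, hornerXn, hornerX, hornerC).
  ring.
have -> : N - (3 * a) *: D = ('X - a%:P) ^+ 3.
  rewrite /N /D /f_num /f_den tE sE -!mul_polyC; ring.
by rewrite mup_XsubCX eqxx.
Qed.

End Ramification.

(** * Base change to K, and rational points *)

Lemma ratfrac_map_f (F K : fieldType) (iota : {rmorphism F -> K}) (s t : F) :
  t * (1 + s + t) != 0 ->
  ratfrac_map iota (f_ s t) = f_ (iota s) (iota t).
Proof.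
move=> st0; rewrite {1}/f_ ratfrac_map_coprime ?f_den_neq0 ?f_coprime //.
congr (toratfrac _ / toratfrac _).
  by rewrite !rmorphD /= map_polyXn map_polyZ map_polyX map_polyC.
by rewrite rmorphM rmorphB /= rmorph1 map_polyX.
Qed.

Lemma map_G (F K : fieldType) (iota : {rmorphism F -> K}) (s t : F) :
  map_poly iota (G_ s t) = G_ (iota s) (iota t).
Proof.
rewrite /G_ !rmorphD !rmorphN /= !map_polyZ !map_polyXn map_polyX map_polyC.
by rewrite /= rmorphM rmorph_nat.
Qed.

Lemma point_degree_rational (F K : fieldType) (iota : {rmorphism F -> K}) c :
  point_degree iota (Some (iota c)) 1.
Proof.
have := @point_degree_root F K iota ('X - c%:P) (iota c) (irredp_XsubC c).
by rewrite size_XsubC; apply; rewrite map_polyXsubC root_XsubC.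
Qed.

Lemma XsubC_sqr_ndvd (K : fieldType) (R : {poly K}) a :
  ~~ root R a -> ~~ (('X - a%:P) ^+ 2 %| R * ('X - a%:P)).
Proof.
by move=> Ra; rewrite exprS expr1 dvdp_mul2r ?polyXsubC_eq0 // dvdp_XsubCl.
Qed.

(** * The family attached to a nonsquare 1 - u + u^2 *)

Section NonsquareCase.

Variables (F : fieldType) (u : F).
Hypothesis nsq : ~ (exists v : F, v ^+ 2 = 1 - u + u ^+ 2).

Let t := - u ^+ 3.
Let s := 3 * (- u + u ^+ 2).
Let Q : {poly F} := 'X^2 + (2 * (u - 1)) *: 'X - u%:P.

Lemma G_factor : G_ s t = ('X - u%:P) ^+ 2 * Q.
Proof. by rewrite /G_ /Q /s /t -!mul_polyC; ring. Qed.

Lemma nonsquare_st_neq0 : t * (1 + s + t) != 0.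
Proof.
have -> : t * (1 + s + t) = (u * (u - 1)) ^+ 3 by rewrite /t /s; ring.
(* For u = 0 or u = 1 the quantity 1 - u + u^2 equals 1, a square. *)
apply/eqP => /eqP; rewrite expf_eq0 mulf_eq0 subr_eq0 /= => /orP[]/eqP u01.
  by apply: nsq; exists 1; rewrite u01; ring.
by apply: nsq; exists 1; rewrite u01; ring.
Qed.

Lemma quadratic_no_root x : ~~ root Q x.
Proof.
apply/negP; rewrite rootE /Q.
rewrite !(hornerD, hornerN, hornerZ, hornerXn, hornerX, hornerC).
(* Completing the square: Q(x) = (x + u - 1)^2 - (1 - u + u^2). *)
move/eqP => h; apply: nsq; exists (x + u - 1).
by rewrite -[RHS]addr0 -h; ring.
Qed.

Lemma quadratic_size : size Q = 3%N.
Proof.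
rewrite /Q -addrA size_polyDl size_polyXn //.
rewrite (leq_ltn_trans (size_polyD _ _)) // gtn_max size_polyN size_polyC.
by rewrite (leq_ltn_trans (size_scale_leq _ _)) ?size_polyX //; case: (_ == _).
Qed.

Lemma quadratic_irreducible : irreducible_poly Q.
Proof.
by apply: cubic_irreducible quadratic_no_root; rewrite quadratic_size.
Qed.

Lemma nonsquare_class_IIId : class_IIId s t.
Proof.
split; first exact: nonsquare_st_neq0.
  by exists u; rewrite G_factor rootM root_exp_XsubC eqxx.
move=> x; rewrite G_factor rootM (negPf (quadratic_no_root x)) orbF.
rewrite root_exp_XsubC => /eqP->.
by rewrite /t opprK.
Qed.

Lemma nonsquare_ramification_type (K : closedFieldType)
    (iota : {rmorphism F -> K}) : (2 : F) != 0 ->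
  has_ramification_type iota (f_ s t)
    [:: (2%:Z, 2%N); (2%:Z, 2%N); (3%:Z, 1%N)].
Proof.
move=> two_neq0; have st0 := nonsquare_st_neq0.
have ist0 : iota t * (1 + iota s + iota t) != 0.
  by rewrite -(rmorph1 iota) -!rmorphD -rmorphM fmorph_eq0.
have [w1 w1Q] : exists w, root (map_poly iota Q) w.
  by apply/closed_rootP; rewrite size_map_poly quadratic_size.
(* The second root comes from the sum of the roots, -2(v - 1). *)
pose v := iota u; pose w2 := - (2 * (v - 1)) - w1.
have iQ : map_poly iota Q = 'X^2 + (2 * (v - 1)) *: 'X - v%:P.
  rewrite /Q !rmorphD rmorphN /= map_polyZ map_polyXn map_polyX map_polyC.
  by rewrite /= rmorphM rmorphB rmorph1 rmorph_nat.
have w1E : w1 ^+ 2 + 2 * (v - 1) * w1 - v = 0.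
  move: w1Q; rewrite iQ rootE.
  by rewrite !(hornerD, hornerN, hornerZ, hornerXn, hornerX, hornerC) => /eqP.
have Qfact : map_poly iota Q = ('X - w1%:P) * ('X - w2%:P).
  have prod_w : w1 * w2 = - v by rewrite -[LHS]addr0 -w1E /w2; ring.
  have -> : ('X - w1%:P) * ('X - w2%:P)
      = 'X^2 - (w1 + w2)%:P * 'X + (w1 * w2)%:P by ring.
  by rewrite iQ prod_w /w2 -mul_polyC; ring.
have w2Q : root (map_poly iota Q) w2.
  by rewrite Qfact rootM !root_XsubC eqxx orbT.
have vw w : root (map_poly iota Q) w -> v != w.
  move=> wQ; apply: contraTneq wQ => <-.
  by rewrite fmorph_root quadratic_no_root.
(* Separability: since 2 is invertible, equal roots would both be 1 - v, which forces 1 - u + u^2 =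
   0, the square of 0. *)
have w12 : w1 != w2.
  rewrite -subr_eq0; have -> : w1 - w2 = 2 * (w1 + v - 1) by rewrite /w2; ring.
  rewrite mulf_neq0 //; first by rewrite -(rmorph_nat iota) fmorph_eq0.
  apply/eqP => w1v; apply: nsq; exists 0; apply: (fmorph_inj iota).
  have {}w1v : w1 = 1 - v by rewrite -[RHS]addr0 -w1v; ring.
  have -> : iota (1 - u + u ^+ 2) = - (w1 ^+ 2 + 2 * (v - 1) * w1 - v).
    by rewrite rmorphD rmorphB rmorph1 rmorphXn /= -/v w1v; ring.
  by rewrite w1E oppr0 rmorphXn rmorph0 expr0n.
have iG : G_ (iota s) (iota t)
    = ('X - v%:P) ^+ 2 * (('X - w1%:P) * ('X - w2%:P)).
  by rewrite -map_G G_factor rmorphM rmorphXn /= map_polyXsubC Qfact.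
(* Stated for either ordering of the two conjugate roots, so that it serves both; w is a simple root
   of G here. *)
have e2 w w' : v != w -> w != w' ->
  G_ (iota s) (iota t) = ('X - v%:P) ^+ 2 * (('X - w%:P) * ('X - w'%:P)) ->
  ram_index (f_ (iota s) (iota t)) (Some w) = 2%:Z.
  move=> vw' ww' E; have E' : G_ (iota s) (iota t) =
    (('X - v%:P) ^+ 2 * ('X - w'%:P)) * ('X - w%:P) by rewrite E mulrA mulrAC.
  apply: ram_index_eq2 => //; rewrite E'.
    by rewrite rootM root_XsubC eqxx orbT.
  apply: XsubC_sqr_ndvd; rewrite rootM negb_or root_XsubC ww' andbT.
  by rewrite root_exp_XsubC eq_sym.
have e1 : ram_index (f_ (iota s) (iota t)) (Some w1) = 2%:Z.
  by apply: e2 iG => //; apply: vw.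
have {}e2 : ram_index (f_ (iota s) (iota t)) (Some w2) = 2%:Z.
  by apply: (@e2 _ w1); rewrite ?vw 1?eq_sym // iG [_ * ('X - w2%:P)]mulrC.
have e3 : ram_index (f_ (iota s) (iota t)) (Some v) = 3%:Z.
  apply: ram_index_eq3 => //; first by rewrite /t rmorphN rmorphXn.
  by rewrite /s rmorphM rmorph_nat rmorphD rmorphN rmorphXn.
have [vw1 vw2] : v != w1 /\ v != w2 by split; apply: vw.
exists [:: Some w1; Some w2; Some v], (fun a => if a == Some v then 1 else 2)%N.
rewrite ratfrac_map_f //; split.
- rewrite /= !inE !(inj_eq Some_inj) (negPf w12) ![_ == v]eq_sym.
  by rewrite (negPf vw1) (negPf vw2).
- case=> [a|]; rewrite ram_index_gt1 // !inE ?(inj_eq Some_inj) // iG !rootM.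
  by rewrite !root_XsubC orbb orbA [RHS]orbC.
- have deg2 w : root (map_poly iota Q) w -> point_degree iota (Some w) 2.
    move=> wQ; have := point_degree_root quadratic_irreducible wQ.
    by rewrite quadratic_size.
  move=> a; rewrite !inE => /or3P[]/eqP->; rewrite (inj_eq Some_inj).
  + by rewrite eq_sym (negPf vw1); apply: deg2.
  + by rewrite eq_sym (negPf vw2); apply: deg2.
  + by rewrite eqxx; apply: point_degree_rational.
- move: (ram_index _) e1 e2 e3 => e e1 e2 e3.
  rewrite /= !(inj_eq Some_inj) ![_ == v]eq_sym.
  by rewrite (negPf vw1) (negPf vw2) eqxx e1 e2 e3.
Qed.

End NonsquareCase.

(** * Primitive cube roots of unity and the pair (-3, 1) *)

Section CubeRootOfUnity.

Variables (F : fieldType) (eps : F).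
Hypothesis eps_prim : 3.-primitive_root eps.

Lemma prim3_sum : eps ^+ 2 + eps + 1 = 0.
Proof.
have e1 : eps - 1 != 0.
  by rewrite subr_eq0 -[eps]expr1 -(prim_order_dvd eps_prim).
apply: (mulfI e1); rewrite mulr0.
have -> : (eps - 1) * (eps ^+ 2 + eps + 1) = eps ^+ 3 - 1 by ring.
by rewrite (prim_expr_order eps_prim) subrr.
Qed.

(** The roots of the sixth cyclotomic polynomial are the negatives of the primitive cube roots of
    unity; expanding uses eps^3 = 1 and eps + eps^2 = -1. *)
Lemma cyclotomic6_factor :
  1 - 'X + 'X^2 = ('X + eps%:P) * ('X + (eps ^+ 2)%:P) :> {poly F}.
Proof.
have -> : ('X + eps%:P) * ('X + (eps ^+ 2)%:P)
   = (eps ^+ 3)%:P + (eps ^+ 2 + eps + 1 - 1) *: 'X + 'X^2.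
  by rewrite -mul_polyC; ring.
by rewrite prim3_sum (prim_expr_order eps_prim) sub0r scaleN1r.
Qed.

End CubeRootOfUnity.

Lemma G_m3_1 (F : fieldType) : G_ (-3 : F) 1 = (1 - 'X + 'X^2) ^+ 2.
Proof. rewrite /G_ -!mul_polyC; ring. Qed.

Lemma m3_1_neq0 (F : fieldType) : 1 * (1 + -3 + 1) != 0 :> F.
Proof.
have -> : 1 * (1 + -3 + 1) = -1 :> F by ring.
by rewrite oppr_eq0 oner_eq0.
Qed.

Lemma cyclotomic6_root (F : fieldType) (x : F) :
  root (1 - 'X + 'X^2) x -> x ^+ 2 = x - 1.
Proof.
rewrite rootE !(hornerD, hornerN, hornerXn, hornerX, hornerC) => /eqP h.
by rewrite -[LHS]subr0 -h; ring.
Qed.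

Lemma class_IIId_m3_1 (F : fieldType) (eps : F) :
  3.-primitive_root eps -> class_IIId (-3 : F) 1.
Proof.
move=> eps_prim; split; first exact: m3_1_neq0.
  exists (- eps); rewrite G_m3_1 (cyclotomic6_factor eps_prim).
  by rewrite rootE horner_exp hornerM hornerD hornerX hornerC addNr mul0r
    expr0n.
move=> x; rewrite G_m3_1 rootE horner_exp expf_eq0 /= -rootE.
(* From x^2 = x - 1 one gets x^3 = x^2 - x = -1. *)
by move/cyclotomic6_root => x2; rewrite exprS x2 mulrBr -expr2 x2; ring.
Qed.

Lemma ramification_type_m3_1 (F K : fieldType) (iota : {rmorphism F -> K})
    (eps : F) :
  3.-primitive_root eps ->
  has_ramification_type iota (f_ (-3 : F) 1) [:: (3%:Z, 1%N); (3%:Z, 1%N)].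
Proof.
move=> eps_prim.
pose w1 := iota (- eps); pose w2 := iota (- eps ^+ 2).
have w12 : w1 != w2.
  (* The exponents 1 and 2 differ modulo the order 3 of eps. *)
  rewrite (inj_eq (fmorph_inj iota)) eqr_opp -[X in X == _]expr1.
  by rewrite (eq_prim_root_expr eps_prim).
have iG : G_ (-3 : K) 1 = (('X - w1%:P) * ('X - w2%:P)) ^+ 2.
  rewrite G_m3_1; congr (_ ^+ 2).
  have := congr1 (map_poly iota) (cyclotomic6_factor eps_prim).
  rewrite rmorphM !rmorphD rmorphN /= rmorph1 map_polyX map_polyXn
    !map_polyC /=.
  by rewrite /w1 /w2 !rmorphN /= !opprK.
have Groot a : root (G_ (-3 : K) 1) a = (a == w1) || (a == w2).
  by rewrite iG rootE horner_exp expf_eq0 /= -rootE rootM !root_XsubC.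
have e3 a : root (G_ (-3 : K) 1) a ->
    ram_index (f_ (-3 : K) 1) (Some a) = 3%:Z.
  rewrite G_m3_1 rootE horner_exp expf_eq0 /= -rootE => /cyclotomic6_root a2.
  (* A root a has a^3 = -1 and a^2 - a = -1, so the pair (-3, 1) is (3(a^2 - a), -a^3). *)
  apply: ram_index_eq3; first exact: m3_1_neq0.
    by rewrite exprS a2 mulrBr -expr2 a2; ring.
  by rewrite a2; ring.
exists [:: Some w1; Some w2], (fun => 1%N).
rewrite ratfrac_map_f ?m3_1_neq0 // rmorphN rmorph_nat rmorph1; split.
- by rewrite /= inE (inj_eq Some_inj) w12.
- case=> [a|]; rewrite ram_index_gt1 ?m3_1_neq0 // !inE ?(inj_eq Some_inj) //.
- by move=> a; rewrite !inE => /orP[]/eqP->; apply: point_degree_rational.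
- have [] : ram_index (f_ (-3 : K) 1) (Some w1) = 3%:Z
      /\ ram_index (f_ (-3 : K) 1) (Some w2) = 3%:Z.
    by split; apply: e3; rewrite Groot eqxx ?orbT.
  by move: (ram_index _) => e /= -> ->.
Qed.

(** The unit group has order q - 1, divisible by 3, so Cauchy's theorem gives a unit of order 3. *)
Lemma finField_prim3 (F : finFieldType) :
  #|F| = 1 %[mod 6] -> exists eps : F, 3.-primitive_root eps.
Proof.
move=> F1; have d3 : (3 %| #|[set: {unit F}]|)%N.
  rewrite card_finField_unit -subn1 -eqn_mod_dvd.
    by rewrite -(modn_dvdm #|F| (isT : 3 %| 6)%N) F1.
  by rewrite ltnW // finNzRing_gt1.
have [x _ ox] := Cauchy (isT : prime 3) d3.
have x3 : val x ^+ 3 = 1.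
  by rewrite -FinRing.val_unitX -[in X in (x ^+ X)%g]ox expg_order.
have [m m_prim m3] := prim_order_exists (isT : 0 < 3)%N x3.
exists (val x); move: m_prim.
(* The exact order m divides 3; m = 1 would make x trivial, against its order 3 in the unit
   group. *)
have /orP[/eqP->|/eqP->//] : (m == 1) || (m == 3) by apply: (primeP _).2 m3.
move/prim_expr_order; rewrite expr1 => x1.
by move: ox; rewrite (_ : x = 1%g) ?order1 //; apply: val_inj.
Qed.

Theorem theorem6p21 (p n q : nat) (F : finFieldType) (K : closedFieldType)
    (iota : {rmorphism F -> K})
    (p_prime : prime p) (p_ge5 : (5 <= p)%N) (n_gt0 : (0 < n)%N)
    (q_def : q = (p ^ n)%N) (card_F : #|F| = q)
    (K_alg : integralRange iota) :
  (forall u : F, ~ (exists v : F, v ^+ 2 = 1 - u + u ^+ 2) ->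
     let t := - u ^+ 3 in
     let s := 3 * (- u + u ^+ 2) in
     [/\ class_IIId s t,
         G_ s t = ('X - u%:P) ^+ 2 * ('X^2 + (2 * (u - 1)) *: 'X - u%:P),
         irreducible_poly ('X^2 + (2 * (u - 1)) *: 'X - u%:P)
       & has_ramification_type iota (f_ s t)
           [:: (2%:Z, 2%N); (2%:Z, 2%N); (3%:Z, 1%N)]])
  /\
  (q = 1 %[mod 6] ->
     [/\ class_IIId (-3 : F) 1,
         G_ (-3 : F) 1 = (1 - 'X + 'X^2) ^+ 2,
         exists eps : F, 3.-primitive_root eps,
         forall eps : F, 3.-primitive_root eps ->
           (1 - 'X + 'X^2) ^+ 2
             = (('X + eps%:P) * ('X + (eps ^+ 2)%:P)) ^+ 2
       & has_ramification_type iota (f_ (-3 : F) 1)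
           [:: (3%:Z, 1%N); (3%:Z, 1%N)]]).
Proof.
have q_F : #|F| = (p ^ n)%N by rewrite card_F.
have two_neq0 : (2 : F) != 0.
  (* F has characteristic p >= 5, which therefore does not divide 2. *)
  have pF := card_finPcharP q_F p_prime.
  rewrite -(dvdn_pcharf pF); apply/negP => /dvdn_leq -/(_ isT).
  by rewrite leqNgt (leq_trans _ p_ge5).
split=> [u nsq t s|q1].
  split; [exact: nonsquare_class_IIId | exact: G_factor | |].
    exact: quadratic_irreducible.
  exact: nonsquare_ramification_type.
have [eps eps_prim] : exists eps : F, 3.-primitive_root eps.
  by apply: finField_prim3; rewrite card_F.
split; [exact: class_IIId_m3_1 eps_prim | exact: G_m3_1 | by exists eps | |].
  by move=> eps' eps'_prim; rewrite (cyclotomic6_factor eps'_prim).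
exact: ramification_type_m3_1 eps_prim.
Qed.
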